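(* Let $f\in\mathbb{R}[x_1,\ldots,x_n]$, let $g=(g_1,\ldots,g_r)$ and $h=(h_1,\ldots,h_s)$ with $g_i,h_j\in\mathbb{R}[x_1,\ldots,x_n]$, let $S=\{x\in\mathbb{R}^n:g(x)=0,\ h(x)\le0\}$, and let $\bar x\in S$. Assume that for every nonzero critical direction $u$ the gradients $\nabla g_i(\bar x)$, $i=1,\ldots,r$, $\nabla h_j(\bar x)$, $j\in I_0(\bar x;u)$, are linearly independent and that the corresponding family of gradients remains of constant rank on the active stratum selected by $u$, i.e. at all points $x$ near $\bar x$ with $g(x)=0$ and $h_j(x)=0$ for $j\in I_0(\bar x;u)$. Suppose that there are multipliers $\lambda\in\mathbb{R}^r$ and $\mu\in\mathbb{R}^s$ with $\mu_j\ge0$ for all $j$, satisfying $$\nabla f(\bar x)+Dg(\bar x)^T\lambda+Dh(\bar x)^T\mu=0,\qquad \mu_jh_j(\bar x)=0\quad(j=1,\ldots,s).$$ Let $L(x,\lambda,\mu)=f(x)+\sum_{i=1}^r\lambda_ig_i(x)+\sum_{j=1}^s\mu_jh_j(x)$. Then for every critical direction $u$ and every $w\in\mathcal{L}^2_S(\bar x;u)$, $$Q_f(\bar x;u,w)=u^T\nabla^2_{xx}L(\bar x,\lambda,\mu)u-\sum_{j\in I_0(\bar x;u)}\mu_j\big(\nabla h_j(\bar x)w+u^T\nabla^2h_j(\bar x)u\big).$$ Consequently, $$Q_f(\bar x;u,w)\ge u^T\nabla^2_{xx}L(\bar x,\lambda,\mu)u.$$ In particular, if $u^T\nabla^2_{xx}L(\bar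 x,\lambda,\mu)u>0$ uniformly on all unit critical directions (i.e. there is $\eta>0$ with $u^T\nabla^2_{xx}L(\bar x,\lambda,\mu)u\ge\eta$ for every critical direction $u$ with $\|u\|=1$), then quadratic growth holds at $\bar x$: there exist $c>0$ and $\varepsilon>0$ such that $f(x)\ge f(\bar x)+c\|x-\bar x\|^2$ for all $x\in S\cap B(\bar x,\varepsilon)$.
   Context: Bouligand tangent cone: $T_S(\bar x)=\{u\in\mathbb{R}^n:\exists t_k\downarrow 0,\ \exists u_k\to u \text{ with } \bar x+t_ku_k\in S\text{ for all }k\}$ ($t_k\downarrow0$ means $t_k>0$, $t_k\to0$). A critical direction (for $f$ at $\bar x$) is a $u\in T_S(\bar x)$ with $\nabla f(\bar x)u=0$. Active indices: $I(\bar x)=\{j\in\{1,\ldots,s\}:h_j(\bar x)=0\}$, $I_0(\bar x;u)=\{j\in I(\bar x):\nabla h_j(\bar x)u=0\}$. $\mathcal{L}^2_S(\bar x;u)$ is the set of $w\in\mathbb{R}^n$ with $Dg(\bar x)w+D^2g(\bar x)[u,u]=0$ and $\nabla h_j(\bar x)w+u^T\nabla^2h_j(\bar x)u\le0$ for all $j\in I_0(\bar x;u)$, where $D^2g(\bar x)[u,u]=(u^T\nabla^2g_i(\bar x)u)_{i=1}^r$. $Q_f(\bar x;u,w)=\nabla f(\bar x)w+u^T\nabla^2f(\bar x)u$, where $\nabla f(\bar x)w$ denotes the inner product of the gradient with $w$. $\nabla^2_{xx}L$ is the Hessian of $L$ in $x$. $B(\bar x,\varepsilon)$ is the Euclidean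 ball. *)

(* Defs.v *)
From HB Require Import structures.
From mathcomp Require Import all_boot all_order all_algebra.
From mathcomp Require Import all_classical all_reals all_analysis.
(* The notations of mpoly clash with those of MathComp-Analysis:
   mpoly n R is {mpoly R[n]}, meval v p is p.@[v], mderiv i p is p^`M(i). *)
From mathcomp Require Import -(notations) mpoly.
Set Implicit Arguments.
Unset Strict Implicit.
Unset Printing Implicit Defensive.
Import Order.TTheory GRing.Theory Num.Theory.
Import numFieldNormedType.Exports.
Local Open Scope classical_set_scope.
Local Open Scope ring_scope.

Definition dotv (R : realType) (n : nat) (a b : 'cV[R]_n) : R :=
  (a^T *m b) 0 0.

Definition qform (R : realType) (n : nat) (H : 'M[R]_n) (u : 'cV[R]_n) : R :=
  (u^T *m H *m u) 0 0.

(* The library norm `|x| on 'cV[R]_n is the sup norm, hence this one. *)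
Definition enorm (R : realType) (n : nat) (x : 'cV[R]_n) : R :=
  Num.sqrt (dotv x x).

Definition eball (R : realType) (n : nat) (c : 'cV[R]_n) (e : R) :
    set 'cV[R]_n :=
  [set x | enorm (x - c) < e].

Definition peval (R : realType) (n : nat) (p : mpoly n R) (x : 'cV[R]_n) : R :=
  meval (fun i => x i 0) p.

Definition grad (R : realType) (n : nat) (p : mpoly n R) (x : 'cV[R]_n) :
    'cV[R]_n :=
  \col_i peval (mderiv i p) x.

Definition hess (R : realType) (n : nat) (p : mpoly n R) (x : 'cV[R]_n) :
    'M[R]_n :=
  \matrix_(i, j) peval (mderiv i (mderiv j p)) x.

Definition jac (R : realType) (n m : nat) (q : 'I_m -> mpoly n R)
    (x : 'cV[R]_n) : 'M[R]_(m, n) :=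
  \matrix_(i, k) peval (mderiv k (q i)) x.

Definition hess_vec (R : realType) (n m : nat) (q : 'I_m -> mpoly n R)
    (x u : 'cV[R]_n) : 'cV[R]_m :=
  \col_i qform (hess (q i) x) u.

Definition feasible (R : realType) (n r s : nat) (g : 'I_r -> mpoly n R)
    (h : 'I_s -> mpoly n R) : set 'cV[R]_n :=
  [set x | (forall i, peval (g i) x = 0) /\ (forall j, peval (h j) x <= 0)].

(* Bouligand tangent cone; the topology on 'cV[R]_n is the usual one. *)
Definition tangent_cone (R : realType) (n : nat) (S : set 'cV[R]_n)
    (x : 'cV[R]_n) : set 'cV[R]_n :=
  [set u | exists (t : nat -> R) (v : nat -> 'cV[R]_n),
    [/\ forall k, 0 < t k, t @ \oo --> (0 : R), v @ \oo --> u
      & forall k, S (x + t k *: v k)]].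

Definition critical_direction (R : realType) (n : nat) (f : mpoly n R)
    (S : set 'cV[R]_n) (x : 'cV[R]_n) : set 'cV[R]_n :=
  [set u | tangent_cone S x u /\ dotv (grad f x) u = 0].

Definition active (R : realType) (n s : nat) (h : 'I_s -> mpoly n R)
    (x : 'cV[R]_n) : {set 'I_s} :=
  [set j | peval (h j) x == 0]%SET.

Definition active0 (R : realType) (n s : nat) (h : 'I_s -> mpoly n R)
    (x u : 'cV[R]_n) : {set 'I_s} :=
  [set j in active h x | dotv (grad (h j) x) u == 0]%SET.

Definition grad_family (R : realType) (n r s : nat) (g : 'I_r -> mpoly n R)
    (h : 'I_s -> mpoly n R) (J : {set 'I_s}) (x : 'cV[R]_n) : seq 'cV[R]_n :=
  [seq grad (g i) x | i : 'I_r] ++ [seq grad (h j) x | j in J].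

Definition stratum (R : realType) (n r s : nat) (g : 'I_r -> mpoly n R)
    (h : 'I_s -> mpoly n R) (J : {set 'I_s}) : set 'cV[R]_n :=
  [set x | (forall i, peval (g i) x = 0) /\
           (forall j, j \in J -> peval (h j) x = 0)].

Definition constant_rank (R : realType) (n r s : nat) (g : 'I_r -> mpoly n R)
    (h : 'I_s -> mpoly n R) (J : {set 'I_s}) (xbar : 'cV[R]_n) : Prop :=
  \forall x \near xbar, stratum g h J x ->
    (\dim <<grad_family g h J x>> = \dim <<grad_family g h J xbar>>)%VS.

Definition second_order_linearized (R : realType) (n r s : nat)
    (g : 'I_r -> mpoly n R) (h : 'I_s -> mpoly n R) (x u : 'cV[R]_n) :
    set 'cV[R]_n :=
  [set w | jac g x *m w + hess_vec g x u = 0 /\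
    (forall j, j \in active0 h x u ->
      dotv (grad (h j) x) w + qform (hess (h j) x) u <= 0)].

Definition Qf (R : realType) (n : nat) (f : mpoly n R) (x u w : 'cV[R]_n) : R :=
  dotv (grad f x) w + qform (hess f x) u.

(* L(., lam, mu) as a polynomial in x, so that hess gives its x-Hessian. *)
Definition lagrangian (R : realType) (n r s : nat) (f : mpoly n R)
    (g : 'I_r -> mpoly n R) (h : 'I_s -> mpoly n R)
    (lam : 'cV[R]_r) (mu : 'cV[R]_s) : mpoly n R :=
  f + \sum_i lam i 0 *: g i + \sum_j mu j 0 *: h j.

Definition quadratic_growth (R : realType) (n : nat) (f : mpoly n R)
    (S : set 'cV[R]_n) (xbar : 'cV[R]_n) : Prop :=
  exists c eps : R, [/\ 0 < c, 0 < eps &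
    forall x, (S `&` eball xbar eps) x ->
      peval f xbar + c * enorm (x - xbar) ^+ 2 <= peval f x].

(* Main.v *)
Require Import Defs.
From HB Require Import structures.
From mathcomp Require Import all_boot all_order all_algebra.
From mathcomp Require Import all_classical all_reals all_analysis.
From mathcomp Require Import -(notations) mpoly.
From mathcomp Require Import ring lra.
Set Implicit Arguments.
Unset Strict Implicit.
Unset Printing Implicit Defensive.
Import Order.TTheory GRing.Theory Num.Theory.
Import numFieldNormedType.Exports.

(** Both halves rest on one fact: stationarity says that the Lagrangian
    L = f + lam.g + mu.h has zero gradient at xbar, so that Q_L(u, w) does not
    depend on w and equals the quadratic form of the Hessian of L at u.

    Since p |-> Q_p(u, w) is linear in the polynomial p, this reads
      u^T (Hess L) u =
        Q_f(u, w) + sum lam_i Q_(g_i)(u, w) + sum mu_j Q_(h_j)(u, w)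
    (Qf_lagrangian). Membership of w in the second-order linearized set says
    exactly that every Q_(g_i)(u, w) vanishes and that Q_(h_j)(u, w) <= 0 for j
    in I_0(u). The indices outside I_0(u) have mu_j = 0 (critical_mu0): along a
    critical u the first-order identity 0 = sum mu_j (grad h_j . u) is a sum of
    nonpositive terms, so each of them is zero. This gives the identity and the
    inequality.

    Growth is proved by contradiction. If it fails, feasible points
    x_k = xbar + t_k v_k approach xbar with |v_k| = 1 and
    f(x_k) <= f(xbar) + o(t_k^2), and by compactness of the sphere a
    subsequence of v_k converges to a unit tangent direction u
    (tangent_cone_approach). To first order
    grad f . u <= 0, and stationarity gives the converse inequality, so u is
    critical. As mu.h <= 0 on the feasible set with equality at xbar, L inherits
    the bound L(x_k) <= L(xbar) + o(t_k^2); because grad L vanishes at xbar, the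
    second-order expansion (taylor2) makes the Hessian form of L nonpositive at
    u, against the assumed lower bound eta. *)

Local Open Scope classical_set_scope.
Local Open Scope ring_scope.

(** * Inner product, quadratic form and Euclidean norm *)

Lemma dotvE (R : realType) (n : nat) (a b : 'cV[R]_n) :
  dotv a b = \sum_i a i 0 * b i 0.
Proof. by rewrite /dotv mxE; apply: eq_bigr => i _; rewrite mxE. Qed.

Lemma qformE (R : realType) (n : nat) (H : 'M[R]_n) (u : 'cV[R]_n) :
  qform H u = \sum_i \sum_j u i 0 * H i j * u j 0.
Proof.
rewrite /qform mxE exchange_big /=; apply: eq_bigr => j _.
by rewrite mxE mulr_suml; apply: eq_bigr => i _; rewrite mxE.
Qed.

Lemma dotv0l (R : realType) (n : nat) (b : 'cV[R]_n) : dotv 0 b = 0.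
Proof. by rewrite /dotv trmx0 mul0mx mxE. Qed.

Lemma dotvPl (R : realType) (n : nat) c (a a' b : 'cV[R]_n) :
  dotv (c *: a + a') b = c * dotv a b + dotv a' b.
Proof.
rewrite !dotvE mulr_sumr -big_split; apply: eq_bigr => i _.
by rewrite !mxE mulrDl mulrA.
Qed.

Lemma dotvZZ (R : realType) (n : nat) c (a : 'cV[R]_n) :
  dotv (c *: a) (c *: a) = c ^+ 2 * dotv a a.
Proof.
by rewrite !dotvE mulr_sumr; apply: eq_bigr => i _; rewrite !mxE; ring.
Qed.

Lemma qformP (R : realType) (n : nat) c (H K : 'M[R]_n) (u : 'cV[R]_n) :
  qform (c *: H + K) u = c * qform H u + qform K u.
Proof. by rewrite /qform mulmxDr mulmxDl -scalemxAr -scalemxAl !mxE. Qed.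

Lemma qform_dyad (R : realType) (n : nat) (a b u : 'cV[R]_n) :
  qform (a *m b^T) u = dotv a u * dotv b u.
Proof.
rewrite qformE !dotvE mulr_suml; apply: eq_bigr => i _; rewrite mulr_sumr.
apply: eq_bigr => j _; rewrite mxE big_ord1 !mxE; ring.
Qed.

Lemma dotv_ge0 (R : realType) (n : nat) (a : 'cV[R]_n) : 0 <= dotv a a.
Proof. by rewrite dotvE sumr_ge0// => i _; rewrite -expr2 sqr_ge0. Qed.

Lemma enorm_sqr (R : realType) (n : nat) (a : 'cV[R]_n) :
  enorm a ^+ 2 = dotv a a.
Proof. by rewrite sqr_sqrtr// dotv_ge0. Qed.

Lemma enormZ (R : realType) (n : nat) c (a : 'cV[R]_n) :
  0 <= c -> enorm (c *: a) = c * enorm a.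
Proof.
by move=> c0; rewrite /enorm dotvZZ sqrtrM ?sqr_ge0// sqrtr_sqr ger0_norm.
Qed.

Lemma coord_le_enorm (R : realType) (n : nat) (a : 'cV[R]_n) i :
  `|a i 0| <= enorm a.
Proof.
rewrite -sqrtr_sqr ler_sqrt ?dotv_ge0// dotvE (bigD1 i)//= expr2 lerDl.
by rewrite sumr_ge0// => j _; rewrite -expr2 sqr_ge0.
Qed.

(** * Gradients and Hessians of polynomials *)

Lemma pevalP (R : realType) (n : nat) c (p q : mpoly n R) x :
  peval (c *: p + q) x = c * peval p x + peval q x.
Proof. by rewrite /peval mevalD mevalZ. Qed.

Lemma gradP (R : realType) (n : nat) c (p q : mpoly n R) x :
  grad (c *: p + q) x = c *: grad p x + grad q x.
Proof. by apply/colP => i; rewrite !mxE linearP pevalP. Qed.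

Lemma hessP (R : realType) (n : nat) c (p q : mpoly n R) x :
  hess (c *: p + q) x = c *: hess p x + hess q x.
Proof. by apply/matrixP => i j; rewrite !mxE !linearP pevalP. Qed.

Lemma QfP (R : realType) (n : nat) c (p q : mpoly n R) x u w :
  Qf (c *: p + q) x u w = c * Qf p x u w + Qf q x u w.
Proof. rewrite /Qf gradP hessP dotvPl qformP; ring. Qed.

Lemma gradM (R : realType) (n : nat) (p q : mpoly n R) x :
  grad (p * q) x = peval p x *: grad q x + peval q x *: grad p x.
Proof.
by apply/colP => i; rewrite !mxE mderivM /peval mevalD !mevalM; ring.
Qed.

Lemma hessM (R : realType) (n : nat) (p q : mpoly n R) x :
  hess (p * q) x = peval p x *: hess q x + (peval q x *: hess p x +
    (1 *: (grad p x *m (grad q x)^T) + grad q x *m (grad p x)^T)).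
Proof.
apply/matrixP => i j; rewrite !mxE !big_ord1 !mxE mderivM linearD /= !mderivM.
rewrite /peval !mevalD !mevalM; ring.
Qed.

(** The induction on sums of monomials is awkward for differential identities;
    a property stable under products need only be checked on the variables. *)
Lemma mpoly_ring_ind (R : realType) (n : nat) (P : mpoly n R -> Prop) :
  (forall c, P (mpolyC n c)) -> (forall i, P (mpolyX R (mnm1 i))) ->
  (forall p q, P p -> P q -> P (p + q)) ->
  (forall p q, P p -> P q -> P (p * q)) -> forall p, P p.
Proof.
move=> PC PX PD PM; elim/mpolyind => [|c m p _ _ Pp]; first by rewrite -mpolyC0.
apply: PD => //; rewrite -mul_mpolyC; apply: (PM) => //.
have P1 : P 1 by rewrite -mpolyC1.
rewrite mpolyXE_id; apply: (big_ind P P1 PM) => i _.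
by elim: (m i) => [|k IH]; rewrite ?expr0 ?exprS//; apply: PM.
Qed.

(** * Expansion along a sequence approaching a point *)

Lemma cvg_dotv (R : realType) (n : nat) (a b : nat -> 'cV[R]_n)
    (a0 b0 : 'cV[R]_n) :
  a @ \oo --> a0 -> b @ \oo --> b0 ->
  dotv (a k) (b k) @[k --> \oo] --> dotv a0 b0.
Proof.
move=> aa0 bb0; rewrite dotvE; under eq_fun do rewrite dotvE.
have coord (c : nat -> 'cV[R]_n) (c0 : 'cV[R]_n) i :
    c @ \oo --> c0 -> c k i 0 @[k --> \oo] --> c0 i 0.
  move=> cc0; apply: (@cvg_comp _ _ _ c (fun y : 'cV[R]_n => y i 0) _ _ _ cc0).
  exact: coord_continuous.
apply: cvg_big => [|i _]; first exact: add_continuous.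
by apply: cvgM; apply: coord.
Qed.

(** The expansion is stated along sequences, with the remainder divided by
    t_k^2, because in this form it passes to products: the t^2-coefficient of a
    product is p(x) B + q(x) A + (grad p . v)(grad q . v) up to terms of order
    t, and this is the Leibniz rule hessM halved. Here A and B are the
    divided remainders of p and q. *)
Lemma taylor2 (R : realType) (n : nat) (p : mpoly n R) (x u : 'cV[R]_n)
    (t : nat -> R) (v : nat -> 'cV[R]_n) :
  t @ \oo --> (0 : R) -> v @ \oo --> u ->
  exists rem : nat -> R,
    (forall k, peval p (x + t k *: v k) =
       peval p x + t k * dotv (grad p x) (v k) + t k ^+ 2 * rem k) /\
    rem @ \oo --> 2^-1 * qform (hess p x) u.
Proof.
move=> t0 vu; elim/mpoly_ring_ind: p => [c|i|p q [A [pE Acvg]] [B [qE Bcvg]]|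
   p q [A [pE Acvg]] [B [qE Bcvg]]].
- exists (fun=> 0); split=> [k|].
    rewrite (_ : grad _ x = 0); first by rewrite dotv0l /peval !mevalC; ring.
    by apply/colP => i; rewrite !mxE mderivC /peval meval0.
  rewrite (_ : hess _ x = 0); last first.
    by apply/matrixP => i j; rewrite !mxE mderivC mderiv0 /peval meval0.
  by rewrite /qform mulmx0 mul0mx mxE mulr0; exact: cvg_cst.
- have dX j : mderiv j (mpolyX R (mnm1 i)) = mpolyC n (i == j)%:R.
    rewrite mderivX mnm1E; case: eqVneq => [->|_]; last first.
      by rewrite scale0r mpolyC0.
    rewrite scale1r mpolyC1 -mpolyX0; congr mpolyX.
    by apply/mnmP => l; rewrite mnmBE mnm0E subnn.
  exists (fun=> 0); split=> [k|].
    rewrite dotvE (bigD1 i)//= big1 => [|j ji]; last first.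
      by rewrite mxE dX /peval mevalC eq_sym (negbTE ji) mul0r.
    rewrite mxE dX eqxx mulr1n /peval !mevalXU mevalC !mxE; ring.
  rewrite (_ : hess _ x = 0); last first.
    by apply/matrixP => j j'; rewrite !mxE dX mderivC /peval meval0.
  by rewrite /qform mulmx0 mul0mx mxE mulr0; exact: cvg_cst.
- exists (A \+ B); split=> [k|].
    rewrite -[p]scale1r gradP pevalP pevalP dotvPl pE qE /=; ring.
  rewrite -[p]scale1r hessP qformP mul1r mulrDr; exact: cvgD.
- set a := fun k => dotv (grad p x) (v k).
  set b := fun k => dotv (grad q x) (v k).
  have acvg : a @ \oo --> dotv (grad p x) u.
    by apply: cvg_dotv => //; exact: cvg_cst.
  have bcvg : b @ \oo --> dotv (grad q x) u.
    by apply: cvg_dotv => //; exact: cvg_cst.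
  exists (fun k => peval p x * B k + peval q x * A k + a k * b k +
    t k * (a k * B k + b k * A k) + t k * t k * (A k * B k)); split=> [k|].
    rewrite /a /b gradM dotvPl -[_ *: grad p x]addr0 dotvPl dotv0l.
    have pM y : peval (p * q) y = peval p y * peval q y by exact: mevalM.
    rewrite !pM pE qE; ring.
  rewrite hessM !qformP !qform_dyad.
  (* The shape of the limit predicted by the limit laws for the remainder. *)
  set Hp := qform (hess p x) u; set Hq := qform (hess q x) u.
  set Dp := dotv (grad p x) u; set Dq := dotv (grad q x) u.
  rewrite [X in _ --> X](_ : _ =
    peval p x * (2^-1 * Hq) + peval q x * (2^-1 * Hp) + Dp * Dq +
    0 * (Dp * (2^-1 * Hq) + Dq * (2^-1 * Hp)) +
    0 * 0 * ((2^-1 * Hp) * (2^-1 * Hq))); last first.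
    by field.
  by repeat (apply: cvgM || apply: cvgD || exact: cvg_cst || assumption).
Qed.

(** Divide the expansion by t_k and let k tend to infinity. The slack t_k e_k
    with e_k --> 0 serves objective values that only almost decrease. *)
Lemma dotv_grad_le0 (R : realType) (n : nat) (p : mpoly n R) (x u : 'cV[R]_n)
    (t e : nat -> R) (v : nat -> 'cV[R]_n) :
  (forall k, 0 < t k) -> t @ \oo --> (0 : R) -> v @ \oo --> u ->
  e @ \oo --> (0 : R) ->
  (forall k, peval p (x + t k *: v k) <= peval p x + t k * e k) ->
  dotv (grad p x) u <= 0.
Proof.
move=> t_gt0 t0 vu e0 le_p; have [rem [pE remcvg]] := taylor2 p x t0 vu.
have cv : (dotv (grad p x) (v k) + t k * rem k - e k) @[k --> \oo] -->
    dotv (grad p x) u + 0 * (2^-1 * qform (hess p x) u) - 0.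
  apply: cvgB => //; apply: cvgD; last exact: cvgM.
  by apply: cvg_dotv => //; exact: cvg_cst.
rewrite mul0r addr0 subr0 in cv; apply: (cvgr_to_le cv).
apply: nearW => k; rewrite -(ler_pM2l (t_gt0 k)) mulr0.
by have := le_p k; rewrite pE; lra.
Qed.

(** The same at second order: with no linear term one can divide by t_k^2. *)
Lemma qform_hess_le0 (R : realType) (n : nat) (p : mpoly n R) (x u : 'cV[R]_n)
    (t e : nat -> R) (v : nat -> 'cV[R]_n) :
  grad p x = 0 ->
  (forall k, 0 < t k) -> t @ \oo --> (0 : R) -> v @ \oo --> u ->
  e @ \oo --> (0 : R) ->
  (forall k, peval p (x + t k *: v k) <= peval p x + t k ^+ 2 * e k) ->
  qform (hess p x) u <= 0.
Proof.
move=> gp0 t_gt0 t0 vu e0 le_p.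
have [rem [pE remcvg]] := taylor2 p x t0 vu.
have cv : (rem k - e k) @[k --> \oo] --> 2^-1 * qform (hess p x) u - 0.
  exact: cvgB.
suff : 2^-1 * qform (hess p x) u <= 0 by lra.
rewrite subr0 in cv; apply: (cvgr_to_le cv).
apply: nearW => k; rewrite -(ler_pM2l (exprn_gt0 2 (t_gt0 k))) mulr0.
by have := le_p k; rewrite pE gp0 dotv0l; lra.
Qed.

Lemma tangent_grad_le0 (R : realType) (n : nat) (p : mpoly n R)
    (S : set 'cV[R]_n) (x u : 'cV[R]_n) :
  (forall y, S y -> peval p y <= peval p x) -> tangent_cone S x u ->
  dotv (grad p x) u <= 0.
Proof.
move=> le_p [t [v [t_gt0 t0 vu Sv]]].
apply: (dotv_grad_le0 (e := fun=> 0) t_gt0 t0 vu) => // [|k].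
  exact: cvg_cst.
by rewrite mulr0 addr0 le_p.
Qed.

(** * Sequences approaching a point *)

(** The product compactness theorem concerns row vectors, hence the transposes.
    Any cluster point u works: phi m picks a term of rank at least m within
    1/(m+1) of u, and m <= phi m lets limits at infinity pass along phi. *)
Lemma bounded_subseq (R : realType) (n : nat) (v : nat -> 'cV[R]_n) (M : R) :
  (forall k i, `|v k i 0| <= M) ->
  exists (u : 'cV[R]_n) (phi : nat -> nat),
    (forall m, (m <= phi m)%N) /\ v \o phi @ \oo --> u.
Proof.
move=> v_le; pose w k := (v k)^T.
have cpt := @rV_compact R n (fun=> `[- M, M]%classic)
  (fun=> @segment_compact R (- M) M).
have [|u [_ u_cl]] := cpt (w @ \oo) (fmap_proper_filter w eventually_filter).
  exists 0%N => // k _ i /=; rewrite in_itv /= mxE.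
  by rewrite -ler_norml.
have near_u m : exists k, (m <= k)%N /\ ball u (harmonic m) (w k).
  have [] := u_cl (w @` [set k | (m <= k)%N]) (ball u (harmonic m)).
  - by exists m => // k mk /=; exists k.
  - by apply: nbhsx_ballx; rewrite /harmonic invr_gt0.
  - by move=> _ [[k mk <-] uk]; exists k.
have [phi phiP] := choice near_u; exists u^T, phi; split=> [m|].
  by have [] := phiP m.
apply/cvg_ballP => e e0; near=> m; split=> // i j.
rewrite ord1 mxE; have [_ [_ /(_ 0 i)]] := phiP m; rewrite mxE; apply: le_ball.
near: m.
have := @cvg_harmonic R => /cvgr_le/(_ e e0); exact.
Unshelve. all: by end_near.
Qed.

(** Converts the failure of a local property at every scale e into a tangent
    sequence with a unit limit direction, keeping the property at scales e_k
    tending to 0. *)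
Lemma tangent_cone_approach (R : realType) (n : nat) (S : set 'cV[R]_n)
    (x : 'cV[R]_n) (P : R -> 'cV[R]_n -> Prop) :
  (forall e, 0 < e -> exists y, [/\ S y, 0 < enorm (y - x) < e & P e y]) ->
  exists (t e : nat -> R) (v : nat -> 'cV[R]_n) (u : 'cV[R]_n),
    [/\ [/\ forall k, 0 < t k, t @ \oo --> (0 : R) & v @ \oo --> u],
        e @ \oo --> (0 : R), enorm u = 1 /\ (forall k, enorm (v k) = 1) &
        forall k, S (x + t k *: v k) /\ P (e k) (x + t k *: v k)].
Proof.
move=> near_x.
have /choice[y yP] k : exists y, [/\ S y, 0 < enorm (y - x) < harmonic k
    & P (harmonic k) y].
  by apply: near_x; rewrite /harmonic invr_gt0.
pose t k := enorm (y k - x); pose v k := (t k)^-1 *: (y k - x).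
have t_gt0 k : 0 < t k by have [_ /andP[]] := yP k.
have v1 k : enorm (v k) = 1.
  by rewrite enormZ ?invr_ge0 ?ltW// mulVf// gt_eqF// t_gt0.
have xv k : x + t k *: v k = y k.
  by rewrite scalerA mulfV ?gt_eqF// scale1r addrC subrK.
have [|u [phi [phi_ge vu]]] := bounded_subseq (v := v) (M := 1).
  by move=> k i; rewrite -(v1 k) coord_le_enorm.
have harm0 : (harmonic \o phi) @ \oo --> (0 : R).
  apply: (@squeeze_cvgr _ _ _ _ (fun=> 0) harmonic) => //; last 2 first.
  - exact: cvg_cst.
  - exact: cvg_harmonic.
  apply: nearW => k /=; rewrite /harmonic invr_ge0 ler0n /=.
  by rewrite lef_pV2 ?posrE// ler_nat ltnS.
exists (t \o phi), (harmonic \o phi), (v \o phi), u; split=> //.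
- split=> // [k|]; first exact: t_gt0.
  apply: (@squeeze_cvgr _ _ _ _ (fun=> 0) (harmonic \o phi)) => //; last first.
    exact: cvg_cst.
  by apply: nearW => k /=; have [_ /andP[/ltW-> /ltW->]] := yP (phi k).
- split=> [|k]; last exact: v1.
  rewrite /enorm (_ : dotv u u = 1) ?sqrtr1//.
  have := cvg_dotv vu vu.
  under eq_fun do rewrite /= -enorm_sqr v1 expr1n.
  by move=> /cvg_lim <- //; rewrite lim_cst.
- by move=> k /=; rewrite xv; have [? _ ?] := yP (phi k).
Qed.

(** * Multipliers and critical directions *)

(** L is a linear combination of f, the g_i and the h_j; this is applied to
    evaluation, to partial derivatives and to p |-> Qf p x u w. *)
Lemma scalar_lagrangian (R : realType) (n r s : nat) (f : mpoly n R)
    (g : 'I_r -> mpoly n R) (h : 'I_s -> mpoly n R)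
    (lam : 'cV[R]_r) (mu : 'cV[R]_s) (phi : mpoly n R -> R) :
  scalar phi ->
  phi (lagrangian f g h lam mu) =
    phi f + \sum_i lam i 0 * phi (g i) + \sum_j mu j 0 * phi (h j).
Proof.
move=> lin_phi.
have phiD p q : phi (p + q) = phi p + phi q.
  by rewrite -[p]scale1r lin_phi scale1r mul1r.
have phi0 : phi 0 = 0 by apply: (addIr (phi 0)); rewrite -phiD !add0r.
have phiZ c p : phi (c *: p) = c * phi p.
  by rewrite -[c *: p]addr0 lin_phi phi0 addr0.
rewrite /lagrangian !phiD !(big_morph phi phiD phi0).
by congr (_ + _ + _); apply: eq_bigr => i _; rewrite phiZ.
Qed.

Lemma grad_lagrangian (R : realType) (n r s : nat) (f : mpoly n R)
    (g : 'I_r -> mpoly n R) (h : 'I_s -> mpoly n R)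
    (lam : 'cV[R]_r) (mu : 'cV[R]_s) x :
  grad (lagrangian f g h lam mu) x =
    grad f x + (jac g x)^T *m lam + (jac h x)^T *m mu.
Proof.
apply/colP => i; rewrite 5!mxE.
rewrite (scalar_lagrangian f g h lam mu (phi := fun p => peval (mderiv i p) x)).
  rewrite !mxE; congr (_ + _ + _); apply: eq_bigr => j _; rewrite !mxE mulrC//.
by move=> c p q /=; rewrite linearP pevalP.
Qed.

Lemma Qf_w0 (R : realType) (n : nat) (p : mpoly n R) (x w : 'cV[R]_n) :
  Qf p x 0 w = dotv (grad p x) w.
Proof. by rewrite /Qf /qform mulmx0 mxE addr0. Qed.

Lemma jac_hess_vecE (R : realType) (n m : nat) (q : 'I_m -> mpoly n R) x u w i :
  (jac q x *m w + hess_vec q x u) i 0 = Qf (q i) x u w.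
Proof.
rewrite /Qf dotvE !mxE; congr (_ + _).
by apply: eq_bigr => k _; rewrite !mxE.
Qed.

(** Each constraint is maximal at x over the feasible set: h_j when it is
    active, and both g_i and - g_i. *)
Lemma feasible_dotv (R : realType) (n r s : nat) (g : 'I_r -> mpoly n R)
    (h : 'I_s -> mpoly n R) (x u : 'cV[R]_n) :
  feasible g h x -> tangent_cone (feasible g h) x u ->
  (forall i, dotv (grad (g i) x) u = 0) /\
  (forall j, j \in active h x -> dotv (grad (h j) x) u <= 0).
Proof.
move=> [gx0 hx0] Tu; split=> [i|j].
  apply/eqP; rewrite eq_le (tangent_grad_le0 _ Tu)/=; last first.
    by move=> y [gy _]; rewrite gx0 gy.
  (* The summand 0 makes - g_i an instance of the linearity lemmas. *)
  have : dotv (grad (-1 *: g i + 0) x) u <= 0.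
    apply: tangent_grad_le0 Tu => y [gy _].
    by rewrite !pevalP gx0 gy /peval !meval0.
  rewrite gradP dotvPl (_ : grad 0 x = 0) ?dotv0l; first by lra.
  by apply/colP => k; rewrite !mxE mderiv0 /peval meval0.
rewrite inE => /eqP hxj0; apply: tangent_grad_le0 Tu => y [_ hy].
by rewrite hxj0.
Qed.

Section FirstOrderStationarity.
Variables (R : realType) (n r s : nat) (f : mpoly n R).
Variables (g : 'I_r -> mpoly n R) (h : 'I_s -> mpoly n R) (xbar : 'cV[R]_n).
Variables (lam : 'cV[R]_r) (mu : 'cV[R]_s).
Hypothesis xbarS : feasible g h xbar.
Hypothesis mu_ge0 : forall j, 0 <= mu j 0.
Hypothesis stationary : grad f xbar + (jac g xbar)^T *m lam
                          + (jac h xbar)^T *m mu = 0.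
Hypothesis complementary : forall j, mu j 0 * peval (h j) xbar = 0.

Let S := feasible g h.
Let L := lagrangian f g h lam mu.

(** The left side is Qf L xbar u w, whatever w is, because the gradient of L
    vanishes at xbar. *)
Lemma Qf_lagrangian u w :
  qform (hess L xbar) u = Qf f xbar u w + \sum_i lam i 0 * Qf (g i) xbar u w
    + \sum_j mu j 0 * Qf (h j) xbar u w.
Proof.
have -> : qform (hess L xbar) u = Qf L xbar u w.
  by rewrite /Qf grad_lagrangian stationary dotv0l add0r.
rewrite (scalar_lagrangian f g h lam mu (phi := fun p => Qf p xbar u w))//.
by move=> c p q; exact: QfP.
Qed.

(** Pairing stationarity with a tangent u kills the g-part. In particular the
    derivative of f along u is nonnegative. *)
Lemma tangent_stationary u : tangent_cone S xbar u ->
  dotv (grad f xbar) u = - \sum_j mu j 0 * dotv (grad (h j) xbar) u /\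
  forall j, mu j 0 * dotv (grad (h j) xbar) u <= 0.
Proof.
move=> Tu; have [gu hu] := feasible_dotv xbarS Tu.
split=> [|j]; last first.
  have [hj|hj] := boolP (j \in active h xbar).
    by rewrite mulr_ge0_le0 ?hu.
  move: (complementary j) => /eqP; rewrite mulf_eq0.
  move: hj; rewrite inE => /negbTE ->; rewrite orbF => /eqP ->.
  by rewrite mul0r.
(* At u = 0 the identity for Qf is the first-order one, with u playing w. *)
have := Qf_lagrangian 0 u.
rewrite /qform mulmx0 mxE Qf_w0.
under eq_bigr do rewrite Qf_w0 gu mulr0.
under [X in _ + X]eq_bigr do rewrite Qf_w0.
by rewrite big1_eq; lra.
Qed.

(** Nonpositive terms that add up to zero all vanish, so a constraint that
    strictly decreases along u has a zero multiplier. *)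
Lemma critical_mu0 u j : critical_direction f S xbar u ->
  j \notin active0 h xbar u -> mu j 0 = 0.
Proof.
move=> [Tu fu0]; have [fE mu_le0] := tangent_stationary Tu.
have {fE} sum0 : \sum_j - (mu j 0 * dotv (grad (h j) xbar) u) = 0.
  by rewrite sumrN -fE.
move/eqP: sum0; rewrite psumr_eq0 => [/allP/(_ j)|k _]; last first.
  by rewrite oppr_ge0.
rewrite mem_index_enum oppr_eq0 mulf_eq0 => /(_ isT)/= /orP[/eqP//|hu].
move: (complementary j) => /eqP; rewrite mulf_eq0 => /orP[/eqP//|hx].
by rewrite !inE hx hu.
Qed.

End FirstOrderStationarity.

(** * Second-order conditions *)

Theorem proposition6p3 (R : realType) (n r s : nat) (f : mpoly n R)
    (g : 'I_r -> mpoly n R) (h : 'I_s -> mpoly n R) (xbar : 'cV[R]_n)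
    (xbarS : feasible g h xbar)
    (regular : forall u : 'cV[R]_n,
      critical_direction f (feasible g h) xbar u -> u != 0 ->
      free (grad_family g h (active0 h xbar u) xbar) /\
      constant_rank g h (active0 h xbar u) xbar)
    (lam : 'cV[R]_r) (mu : 'cV[R]_s)
    (mu_ge0 : forall j, 0 <= mu j 0)
    (stationary : grad f xbar + (jac g xbar)^T *m lam
                    + (jac h xbar)^T *m mu = 0)
    (complementary : forall j, mu j 0 * peval (h j) xbar = 0) :
  let S := feasible g h in
  let HL := hess (lagrangian f g h lam mu) xbar in
  (forall u w : 'cV[R]_n,
     critical_direction f S xbar u ->
     second_order_linearized g h xbar u w ->
     Qf f xbar u w =
       qform HL u - \sum_(j in active0 h xbar u)
         mu j 0 * (dotv (grad (h j) xbar) w + qform (hess (h j) xbar) u)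
     /\ qform HL u <= Qf f xbar u w)
  /\
  ((exists2 eta : R, 0 < eta &
      forall u : 'cV[R]_n, critical_direction f S xbar u -> enorm u = 1 ->
        eta <= qform HL u) ->
   quadratic_growth f S xbar).
Proof.
move=> S HL; split=> [u w crit_u [gw hw]|[eta eta_gt0 HL_ge]].
  have QfE : Qf f xbar u w = qform HL u - \sum_(j in active0 h xbar u)
      mu j 0 * (dotv (grad (h j) xbar) w + qform (hess (h j) xbar) u).
    rewrite /HL (Qf_lagrangian stationary u w).
    rewrite [\sum_i _]big1 => [|i _]; last first.
      by rewrite -jac_hess_vecE gw mxE mulr0.
    rewrite [\sum_j _](bigID (mem (active0 h xbar u)))/=.
    rewrite [X in _ + (_ + X)]big1 => [|j jNI]; last first.
      have -> := critical_mu0 xbarS mu_ge0 stationary complementary crit_u jNI.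
      by rewrite mul0r.
    by rewrite addr0 addr0 addrK.
  split=> //; rewrite QfE lerDl oppr_ge0 sumr_le0// => j jI.
  by rewrite mulr_ge0_le0// hw.
have [//|no_growth] := pselect (quadratic_growth f S xbar).
(* If growth fails with c = eps = e, the offending point is a witness at scale
   e; it differs from xbar because its value is strictly below the bound. *)
have near_xbar e : 0 < e -> exists y, [/\ S y, 0 < enorm (y - xbar) < e &
    peval f y <= peval f xbar + enorm (y - xbar) ^+ 2 * e].
  move=> e_gt0; apply: contra_notP no_growth => none; exists e, e; split=> //.
  move=> y [Sy]; rewrite /eball /= => y_lt; apply: contra_notT none.
  rewrite -ltNge => fy_lt; exists y; split=> //; last by rewrite mulrC ltW.
  rewrite y_lt andbT lt_neqAle sqrtr_ge0 andbT eq_sym; apply/eqP => y0.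
  move: fy_lt; rewrite y0 expr0n mulr0 addr0.
  suff -> : y = xbar by rewrite ltxx.
  apply/colP => i; apply/eqP; rewrite -subr_eq0 -normr_le0 -y0.
  by have := coord_le_enorm (y - xbar) i; rewrite !mxE.
have [t [e [v [u [[t_gt0 t0 vu] e0 [u1 v1] yP]]]]] :=
  tangent_cone_approach near_xbar.
have fy_le k : peval f (xbar + t k *: v k) <= peval f xbar + t k ^+ 2 * e k.
  have [_] := yP k; rewrite [_ - xbar]addrC addKr.
  by rewrite enormZ ?v1 ?mulr1// ltW.
have Tu : tangent_cone S xbar u.
  by exists t, v; split=> // k; have [] := yP k.
have crit_u : critical_direction f S xbar u.
  split=> //; apply/eqP; rewrite eq_le; apply/andP; split.
    apply: (dotv_grad_le0 (e := t \* e) t_gt0 t0 vu) => // [|k].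
      by rewrite -[0](mulr0 0); exact: cvgM.
    by apply: le_trans (fy_le k) _; rewrite /= expr2 mulrA.
  have [-> mu_le0] := tangent_stationary xbarS mu_ge0 stationary
    complementary Tu.
  by rewrite oppr_ge0 sumr_le0.
suff : qform HL u <= 0.
  by have := HL_ge u crit_u u1; lra.
(* On the feasible set the g-part of L vanishes. *)
have pevalL y : S y ->
    peval (lagrangian f g h lam mu) y =
      peval f y + \sum_j mu j 0 * peval (h j) y.
  move=> [gy _].
  rewrite (scalar_lagrangian f g h lam mu (phi := fun p => peval p y)).
    by rewrite [X in _ + X + _]big1 ?addr0// => i _; rewrite gy mulr0.
  by move=> c p q; exact: pevalP.
apply: (qform_hess_le0 _ t_gt0 t0 vu e0) => // [|k].
  by rewrite grad_lagrangian.
have [Sy _] := yP k; rewrite !pevalL// [X in _ <= _ + X + _]big1//.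
rewrite addr0 -[X in _ <= X]addr0 lerD// sumr_le0// => j _.
by rewrite mulr_ge0_le0//; have [_] := Sy.
Qed.
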